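(* For every $\varepsilon>0$ there is $C$ such that for every finite poset $P$ with $n$ elements and every $X\subseteq P$ with $\sum_{x\in X}\mathrm{win}(x)\ge Cn$, there are distinct $x,y\in X$ with $\delta_{xy}>1/e-\varepsilon$.
   Context: $f$ is a uniformly random linear extension of $P$ (order-preserving bijection $P\to\{1,\dots,n\}$). For $x\in P$, $r(x)=\min\{f(y):y>x\}$ ($n+1$ if $x$ is maximal), $q(x)=\max\{f(y):y<x\}$ ($0$ if $x$ is minimal), and $\mathrm{win}(x)=\mathbb{E}[r(x)-q(x)]$. For distinct $x,y$, $\delta_{xy}=\min\{\Pr(f(x)<f(y)),\Pr(f(y)<f(x))\}$. *)

(* Defs.v *)
From HB Require Import structures.
From mathcomp Require Import all_boot all_order all_algebra.
From mathcomp Require Import reals.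

Set Implicit Arguments.
Unset Strict Implicit.
Unset Printing Implicit Defensive.

Import Order.TTheory GRing.Theory Num.Theory.
Local Open Scope ring_scope.

Section LinearExtensions.
Context {d : Order.disp_t} {P : finPOrderType d}.

(* The ordinals 'I_n count from 0; the value f(x) in {1, ..., n} is [pos f x]. *)
Definition is_linext (f : {ffun P -> 'I_#|P|}) : bool :=
  [&& injectiveb f, [forall k, k \in codom f]
    & [forall x, forall y, (x <= y)%O ==> (f x <= f y)%N]].

Lemma is_linextP (f : {ffun P -> 'I_#|P|}) :
  reflect (bijective f /\ forall x y : P, (x <= y)%O -> (f x <= f y)%N)
          (is_linext f).
Proof.
apply: (iffP and3P) => [[/injectiveP injf _ /'forall_forallP homf]|[bijf homf]].
  split=> [|x y]; last by apply/implyP.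
  by apply: inj_card_bij => //; rewrite card_ord.
split; first exact/injectiveP/bij_inj.
  by case: bijf => g _ gK; apply/forallP => k; rewrite -(gK k) codom_f.
by apply/'forall_forallP => x y; apply/implyP/homf.
Qed.

Definition linexts : {set {ffun P -> 'I_#|P|}} := [set f | is_linext f].

Definition pos (f : {ffun P -> 'I_#|P|}) (x : P) : nat := (f x).+1.

(* All values of [pos f] are at most n, so the neutral element n+1 is only
   reached when x is maximal. *)
Definition upper (f : {ffun P -> 'I_#|P|}) (x : P) : nat :=
  \big[minn/#|P|.+1]_(y | (x < y)%O) pos f y.

Definition lower (f : {ffun P -> 'I_#|P|}) (x : P) : nat :=
  \max_(y | (y < x)%O) pos f y.

Section Uniform.
Variable R : realType.

Definition expect (Z : {ffun P -> 'I_#|P|} -> R) : R :=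
  (\sum_(f in linexts) Z f) / #|linexts|%:R.

Definition prob (A : pred {ffun P -> 'I_#|P|}) : R :=
  #|[set f in linexts | A f]|%:R / #|linexts|%:R.

Definition win (x : P) : R :=
  expect (fun f => (upper f x)%:R - (lower f x)%:R).

Definition delta (x y : P) : R :=
  Num.min (prob (fun f => (pos f x < pos f y)%N))
          (prob (fun f => (pos f y < pos f x)%N)).
End Uniform.
End LinearExtensions.

(* Main.v *)
Require Import Defs.
From HB Require Import structures.
From mathcomp Require Import all_boot all_order all_algebra.
From mathcomp Require Import reals sequences exp.
From mathcomp Require Import perm zify ring lra.

(* Consider the order-preserving maps [g : P -> {0, ..., m}] with the uniform
   distribution. For m large almost all of them are injective, and ranking the
   values of an injective one gives a uniform linear extension. The gaps between
   its consecutive values are exchangeable, so the window of [g x] (the interval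
   in which [g x] can move when the other values are fixed) has mean width about
   (m / n) win(x).

   In the coordinates [g i - g x] these maps form a lattice of functions, so the
   four functions theorem shows that the distribution function of [g y - g x] is
   log-concave. For such distributions Grunbaum's argument gives
   P(g y - g x <= K) >= 1/e - O(p) whenever K bounds the mean, where p is the
   largest point probability. Given the other values, [g x] is uniform in its
   window; together with log-concavity this forces p = O(n / (m win(x))).

   It remains to find x, y in X such that |E g x - E g y| is small compared to
   the mean width of the window of [g x]. Otherwise the intervals starting at
   E g x of length proportional to this width are disjoint, which bounds the sum
   of win(x) over X by C n. *)

Import Order.TTheory GRing.Theory Num.Theory.
Set Implicit Arguments.
Unset Strict Implicit.
Unset Printing Implicit Defensive.
Local Open Scope ring_scope.

Section UniformAverage.
Variables (R : realFieldType) (T : finType) (A : {set T}).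
Implicit Types (Y Z : T -> R) (Q : pred T).

Definition avg Z : R := (\sum_(g in A) Z g) / #|A|%:R.
Definition freq Q : R := #|[set g in A | Q g]|%:R / #|A|%:R.

Lemma freq_avg Q : freq Q = avg (fun g => (Q g)%:R).
Proof.
rewrite /freq /avg -sum1_card natr_sum; congr (_ / _).
rewrite [LHS]big_mkcond [RHS]big_mkcond /=; apply: eq_bigr => g _.
by rewrite inE; case: (g \in A); case: (Q g).
Qed.

Lemma ler_avg Y Z : {in A, forall g, Y g <= Z g} -> avg Y <= avg Z.
Proof. by move=> leYZ; rewrite ler_wpM2r ?invr_ge0 // ler_sum. Qed.

Lemma eq_avg Y Z : {in A, Y =1 Z} -> avg Y = avg Z.
Proof. by move=> eqYZ; rewrite /avg (eq_bigr _ eqYZ). Qed.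

Lemma avg_ge0 Z : {in A, forall g, 0 <= Z g} -> 0 <= avg Z.
Proof. by move=> Z_ge0; rewrite divr_ge0 // sumr_ge0. Qed.

Lemma avg_sum (I : Type) (s : seq I) (Q : pred I) (Z : I -> T -> R) :
  avg (fun g => \sum_(i <- s | Q i) Z i g) = \sum_(i <- s | Q i) avg (Z i).
Proof. by rewrite /avg exchange_big mulr_suml. Qed.

Lemma avgD Y Z : avg (fun g => Y g + Z g) = avg Y + avg Z.
Proof. by rewrite /avg big_split mulrDl. Qed.

Lemma avgMl a Z : avg (fun g => a * Z g) = a * avg Z.
Proof. by rewrite /avg -mulr_sumr mulrA. Qed.

Lemma avgB Y Z : avg (fun g => Y g - Z g) = avg Y - avg Z.
Proof. by rewrite /avg sumrB mulrBl. Qed.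

Lemma avg_cst a : (0 < #|A|)%N -> avg (fun=> a) = a.
Proof.
move=> A_gt0; rewrite /avg sumr_const -[a *+ _]mulr_natr mulfK //.
by rewrite pnatr_eq0 -lt0n.
Qed.

Lemma card_mul_avg Z : #|A|%:R * avg Z = \sum_(g in A) Z g.
Proof.
have [A0|A_gt0] := posnP #|A|; last first.
  by rewrite mulrC divfK // pnatr_eq0 -lt0n.
by rewrite A0 mul0r big_pred0 // => g; have := card0_eq A0 g.
Qed.

Lemma freq_ge0 Q : 0 <= freq Q.
Proof. by rewrite divr_ge0. Qed.

Lemma ler_freq (Q Q' : pred T) : {in A, subpred Q Q'} -> freq Q <= freq Q'.
Proof.
move=> subQ; rewrite !freq_avg; apply: ler_avg => g gA.
by rewrite ler_nat; have := subQ g gA; case: (Q g) => // ->.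
Qed.

Lemma freq_le1 Q : freq Q <= 1.
Proof.
have [A0|A_gt0] := posnP #|A|; first by rewrite /freq A0 invr0 mulr0.
rewrite ler_pdivrMr ?ltr0n // mul1r ler_nat.
by apply/subset_leq_card/subsetP => g /setIdP[].
Qed.

End UniformAverage.

Section FourFunctions.
Variables (R : realDomainType) (dT : Order.disp_t) (T : finOrderType dT).
Variable I : finType.

Lemma lerD_of_lerM (a b p q : R) :
  0 <= a -> 0 <= q -> a <= p -> b <= p -> a * b <= p * q -> a + b <= p + q.
Proof.
move=> a_ge0 q_ge0 ap bp ab_pq; have [p_le0|p_gt0] := leP p 0; first lra.
rewrite -(ler_pM2l p_gt0); nra.
Qed.

Lemma four_functions_chain (u v lo hi : T -> R) :
    (forall i, 0 <= u i) -> (forall i, 0 <= v i) ->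
    (forall i, 0 <= lo i) -> (forall i, 0 <= hi i) ->
    (forall i j, u i * v j <= lo (Order.min i j) * hi (Order.max i j)) ->
  (\sum_i u i) * (\sum_i v i) <= (\sum_i lo i) * (\sum_i hi i).
Proof.
move=> u0 v0 lo0 hi0 uv_le.
have symmetrized (y z : T -> R) : ((\sum_i y i) * (\sum_i z i)) *+ 2 =
    \sum_i \sum_j (y i * z j + y j * z i).
  rewrite mulr2n {2}big_distrlr exchange_big big_distrlr -big_split /=.
  by apply: eq_bigr => i _; rewrite -big_split.
rewrite -(ler_pMn2r (isT : 0 < 2)%N) !symmetrized.
apply: ler_sum => i _; apply: ler_sum => j _.
wlog le_ij : i j / (i <= j)%O => [wl|].
  case/orP: (le_total i j) => [|le_ji]; first exact: wl.
  by rewrite addrC [leRHS]addrC; apply: wl.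
have := uv_le i j; rewrite (min_idPl le_ij) (max_idPr le_ij) => uv_ij.
have := uv_le j i; rewrite (min_idPr le_ij) (max_idPl le_ij) => uv_ji.
apply: lerD_of_lerM; rewrite ?mulr_ge0 //.
have := uv_le i i; have := uv_le j j; rewrite !minxx !maxxx => uv_jj uv_ii.
have := ler_pM (mulr_ge0 (u0 i) (v0 i)) (mulr_ge0 (u0 j) (v0 j)) uv_ii uv_jj.
lra.
Qed.

Implicit Types (g h : {ffun I -> T}) (F U V Lo Hi : {ffun I -> T} -> R).

Definition ffun_min g h : {ffun I -> T} := [ffun i => Order.min (g i) (h i)].
Definition ffun_max g h : {ffun I -> T} := [ffun i => Order.max (g i) (h i)].
Definition set_coord g i t : {ffun I -> T} :=
  [ffun j => if j == i then t else g j].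

Fixpoint partial_sum (l : seq I) F g : R :=
  if l is i :: l' then \sum_t partial_sum l' F (set_coord g i t) else F g.

Lemma partial_sum_ge0 l F g : (forall h, 0 <= F h) -> 0 <= partial_sum l F g.
Proof.
move=> F_ge0; elim: l g => //= i l IHl g; apply: sumr_ge0 => t _; exact: IHl.
Qed.

Lemma partial_sumE l F g : uniq l ->
  partial_sum l F g =
  \sum_(h : {ffun I -> T} | [forall j, (j \notin l) ==> (h j == g j)]) F h.
Proof.
elim: l g => [|i l IHl] g /=.
  move=> _; rewrite (big_pred1 g) // => h.
  apply/forallP/eqP => [eq_hg|-> //].
  by apply/ffunP => j; apply/eqP; have := eq_hg j.
case/andP=> il ul.
rewrite [RHS](partition_big (fun h : {ffun I -> T} => h i) predT) //=.
apply: eq_bigr => t _; rewrite IHl //; apply: eq_bigl => h.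
apply/forallP/andP => [eq_hg|[/forallP eq_hg /eqP hi] j].
  split; last by have := eq_hg i; rewrite il ffunE eqxx.
  apply/forallP => j; apply/implyP; rewrite inE negb_or => /andP[ji jl].
  by have := eq_hg j; rewrite jl ffunE (negPf ji).
apply/implyP => jl; rewrite ffunE; case: (eqVneq j i) => [->|ji].
  exact/eqP.
by have := eq_hg j; rewrite inE (negPf ji) jl.
Qed.

Lemma partial_sum_enum F g : partial_sum (enum I) F g = \sum_h F h.
Proof.
rewrite partial_sumE ?enum_uniq //; apply: eq_bigl => h.
by apply/forallP => j; rewrite mem_enum.
Qed.

Lemma four_functions U V Lo Hi :
    (forall g, 0 <= U g) -> (forall g, 0 <= V g) ->
    (forall g, 0 <= Lo g) -> (forall g, 0 <= Hi g) ->
    (forall g h, U g * V h <= Lo (ffun_min g h) * Hi (ffun_max g h)) ->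
  (\sum_g U g) * (\sum_g V g) <= (\sum_g Lo g) * (\sum_g Hi g).
Proof.
move=> U_ge0 V_ge0 Lo_ge0 Hi_ge0 UV_le.
have partial_le l g h : partial_sum l U g * partial_sum l V h <=
    partial_sum l Lo (ffun_min g h) * partial_sum l Hi (ffun_max g h).
  elim: l g h => //= i l IHl g h.
  apply: four_functions_chain => [t|t|t|t|t u]; try exact: partial_sum_ge0.
  have -> : set_coord (ffun_min g h) i (Order.min t u) =
      ffun_min (set_coord g i t) (set_coord h i u).
    by apply/ffunP => j; rewrite !ffunE; case: eqP.
  have -> : set_coord (ffun_max g h) i (Order.max t u) =
      ffun_max (set_coord g i t) (set_coord h i u).
    by apply/ffunP => j; rewrite !ffunE; case: eqP.
  exact: IHl.
have [g _|no_ffun] := pickP (@predT {ffun I -> T}).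
  by have := partial_le (enum I) g g; rewrite !partial_sum_enum.
by rewrite !big_pred0 // mul0r.
Qed.

End FourFunctions.

Lemma four_functions_card (dT : Order.disp_t) (T : finOrderType dT)
    (I : finType) (A B Lo Hi : {set {ffun I -> T}}) :
    (forall g h, g \in A -> h \in B ->
       ffun_min g h \in Lo /\ ffun_max g h \in Hi) ->
  (#|A| * #|B| <= #|Lo| * #|Hi|)%N.
Proof.
move=> AB_lattice.
have cardE (S : {set {ffun I -> T}}) : #|S|%:R = \sum_g (g \in S)%:R :> int.
  rewrite -sum1_card natr_sum big_mkcond /=.
  by apply: eq_bigr => g _; case: (g \in S).
rewrite -(ler_nat int) !natrM !cardE; apply: four_functions => // g h.
rewrite -!natrM ler_nat !mulnb.
by case: andP => // -[gA hB]; have [-> ->] := AB_lattice g h gA hB.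
Qed.

Lemma ler_sum_ord_cst (R : numDomainType) n (f : 'I_n -> R) (c : R) :
  (forall j, f j <= c) -> \sum_(j < n) f j <= n%:R * c.
Proof.
move=> f_le; rewrite mulr_natl -[in leRHS](card_ord n) -sumr_const.
exact: ler_sum.
Qed.

Lemma exists_natr_mul_between (R : archiRealFieldType) (a : R) :
  0 < a -> exists2 l : nat, 1 <= a * l%:R & a * l%:R <= 1 + a.
Proof.
move=> a_gt0; exists (Num.truncn a^-1).+1.
  by rewrite -ler_pdivrMl // mulr1 ltW // truncnS_gt.
rewrite -natr1 mulrDr mulr1 lerD2r -ler_pdivlMl // mulr1.
by rewrite truncn_le // invr_ge0 ltW.
Qed.

Section ExpBounds.
Variable R : realType.
Implicit Type a : R.

Lemma expR_le1D a : 0 <= a <= 1 -> expR a <= 1 + a * expR 1.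
Proof.
case/andP=> a_ge0 a_le1.
have e_1Na : expR a * (1 - a) <= 1.
  by rewrite -ler_pdivlMl ?expR_gt0 // mulr1 -expRN expR_ge1Dx.
have : a * expR a <= a * expR 1 by rewrite ler_wpM2l // ler_expR.
lra.
Qed.

Lemma expr1D_le_expR a l : 0 <= a -> (1 + a) ^+ l <= expR (a * l%:R).
Proof.
move=> a_ge0; rewrite mulrC expRM_natl.
by rewrite lerXn2r ?nnegrE ?expR_ge1Dx ?expR_ge0 // addr_ge0.
Qed.

Lemma expR1_ge2 : 2 <= expR 1 :> R.
Proof. by have := expR_ge1Dx (1 : R); lra. Qed.

End ExpBounds.

Definition log_concave (R : numDomainType) (F : nat -> R) : Prop :=
  forall j, F j * F j.+2 <= F j.+1 ^+ 2.

Section LogConcaveSequence.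
Variables (R : realFieldType) (F : nat -> R).
Hypothesis F_ge0 : forall j, 0 <= F j.
Hypothesis F_nd : {homo F : i j / (i <= j)%N >-> i <= j}.
Hypothesis F_lc : log_concave F.

Lemma log_concave_ratio j k : (j <= k)%N -> F j * F k.+1 <= F j.+1 * F k.
Proof.
move=> /subnKC <-; elim: (k - j)%N => [|i IHi]; first by rewrite addn0 mulrC.
rewrite addnS; set l := (j + i)%N in IHi *.
have [Fl_gt0|Fl_le0] := ltP 0 (F l); last first.
  have -> : F j = 0.
    by apply: le_anti; rewrite F_ge0 (le_trans _ Fl_le0) // F_nd ?leq_addr.
  by rewrite mul0r mulr_ge0.
have FlS_gt0 : 0 < F l.+1 by apply: lt_le_trans Fl_gt0 (F_nd (leqnSn l)).
rewrite -(ler_pM2r (mulr_gt0 Fl_gt0 FlS_gt0)).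
have := ler_pM (mulr_ge0 (F_ge0 _) (F_ge0 _)) (mulr_ge0 (F_ge0 _) (F_ge0 _))
  IHi (F_lc l).
lra.
Qed.

Lemma log_concave_sum_le k n : (n <= k.+1)%N ->
  (F k.+1 - F k) * (\sum_(j < n) F j) <= F k * F n.
Proof.
elim: n => [|n IHn] ltnk; first by rewrite big_ord0 mulr0 mulr_ge0.
rewrite big_ord_recr /= mulrDr.
have := IHn (ltnW ltnk); have := @log_concave_ratio n k ltnk; lra.
Qed.

Variables (K : nat) (a : R).
Hypothesis FK_gt0 : 0 < F K.
Hypothesis FK_S : F K.+1 = F K * (1 + a).

Lemma log_concave_increment_ge0 : 0 <= a.
Proof.
rewrite -(pmulr_rge0 _ FK_gt0).
by have := F_nd (leqnSn K); rewrite FK_S -subr_ge0 mulrDr mulr1 addrC addKr.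
Qed.
Let a_ge0 := log_concave_increment_ge0.

Lemma log_concave_geometric i : F (K + i)%N <= F K * (1 + a) ^+ i.
Proof.
elim: i => [|i IHi]; first by rewrite addn0 expr0 mulr1.
rewrite addnS -(ler_pM2l FK_gt0).
apply: le_trans (log_concave_ratio (leq_addr i K)) _.
by rewrite FK_S -mulrA ler_pM2l // exprS mulrCA ler_wpM2l // addr_ge0.
Qed.

Lemma log_concave_sum_geometric l :
  a * (\sum_(j < K + l) F j) <= F K * (1 + a) ^+ l.
Proof.
elim: l => [|l IHl].
  rewrite addn0 expr0 mulr1 -(ler_pM2l FK_gt0).
  have := log_concave_sum_le (leqnSn K); rewrite FK_S; lra.
rewrite addnS big_ord_recr /= mulrDr exprS.
have := ler_wpM2l a_ge0 (log_concave_geometric l); lra.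
Qed.

Hypothesis sum_ge : forall l, l%:R <= \sum_(j < K + l) F j.

Lemma log_concave_flat_ge_half : a = 0 -> 1 / 2 <= F K.
Proof.
move=> a0; have flat : K.+1%:R <= (K + K.+1)%:R * F K.
  apply: le_trans (sum_ge K.+1) (ler_sum_ord_cst _) => j.
  apply: le_trans (F_nd (ltnW (ltn_ord j))) _.
  by have := log_concave_geometric K.+1; rewrite a0 addr0 expr1n mulr1.
move: flat; rewrite addnS -addSn natrD -natr1; have := ler0n R K; nra.
Qed.

End LogConcaveSequence.

Section LogConcaveGrunbaum.
Variables (R : realType) (F : nat -> R) (K : nat).
Hypothesis F_ge0 : forall j, 0 <= F j.
Hypothesis F_nd : {homo F : i j / (i <= j)%N >-> i <= j}.
Hypothesis F_lc : log_concave F.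
(* For a distribution function [F] this says that the mean is at most [K]. *)
Hypothesis sum_ge : forall l, l%:R <= \sum_(j < K + l) F j.

Lemma cdf_at_mean_gt0 : 0 < F K.
Proof.
have sum_le : \sum_(j < K + 1) F j <= (K + 1)%:R * F K.
  by apply: ler_sum_ord_cst => j; apply: F_nd; have := ltn_ord j; lia.
rewrite lt_def F_ge0 andbT; apply: contraTneq (le_trans (sum_ge 1) sum_le).
by move=> ->; rewrite mulr0 -ltNge ltr0n.
Qed.

(* With l close to 1 / a, [log_concave_sum_geometric] bounds 1 by about
   F K * (1 + a)^(1 / a), hence by about F K * e. *)
Lemma log_concave_grunbaum_ratio a :
  F K.+1 = F K * (1 + a) -> (expR 1)^-1 <= F K * (1 + a * expR 1).
Proof.
move=> FK_S; have FK_gt0 := cdf_at_mean_gt0.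
have e_gt0 := expR_gt0 (1 : R); have e_ge2 := expR1_ge2 R.
have a_ge0 := log_concave_increment_ge0 F_nd FK_gt0 FK_S.
rewrite -div1r ler_pdivrMr //.
have [a0|a_neq0] := eqVneq a 0.
  have := log_concave_flat_ge_half F_ge0 F_nd F_lc FK_gt0 FK_S sum_ge a0.
  by rewrite a0 mul0r; nra.
have geometric l : a * l%:R <= F K * (1 + a) ^+ l.
  apply: le_trans (ler_wpM2l a_ge0 (sum_ge l)) _.
  exact: log_concave_sum_geometric.
have [a_ge1|a_lt1] := leP 1 a.
  have a_le : a <= F K * (1 + a * expR 1).
    apply: le_trans (_ : F K * (1 + a) <= _).
      by have := geometric 1%N; rewrite expr1 mulr1.
    by rewrite ler_pM2l // lerD2l; nra.
  by nra.
have [|l al_ge1 al_le] := @exists_natr_mul_between _ a.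
  by rewrite lt_def a_neq0.
apply: le_trans al_ge1 (le_trans (geometric l) _).
rewrite -mulrA ler_pM2l // (le_trans (expr1D_le_expR l a_ge0)) //.
apply: le_trans (_ : expR (1 + a) <= _); first by rewrite ler_expR.
by rewrite expRD mulrC ler_pM2r // expR_le1D // a_ge0 ltW.
Qed.

Lemma log_concave_grunbaum :
  (expR 1)^-1 <= F K + expR 1 * (F K.+1 - F K).
Proof.
have FK_gt0 := cdf_at_mean_gt0; pose a := (F K.+1 - F K) / F K.
have FK_a : F K * a = F K.+1 - F K by rewrite mulrC divfK ?gt_eqF.
have FK_S : F K.+1 = F K * (1 + a) by rewrite mulrDr FK_a mulr1 addrC subrK.
by have := log_concave_grunbaum_ratio FK_S; rewrite -FK_a; lra.
Qed.

End LogConcaveGrunbaum.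

Definition log_concave_law (T : finType) (A : {set T}) (Z : T -> nat) : Prop :=
  forall j, (#|[set g in A | Z g <= j]| * #|[set g in A | Z g <= j.+2]| <=
             #|[set g in A | Z g <= j.+1]| ^ 2)%N.

Section LogConcaveLaw.
Variables (R : realFieldType) (T : finType) (A : {set T}) (Z : T -> nat).
Local Notation cdf j := (freq R A (fun g => Z g <= j)%N).
Local Notation mass j := (freq R A (fun g => Z g == j)).

Lemma freq_leqS k : cdf k.+1 = cdf k + mass k.+1.
Proof.
rewrite !freq_avg -avgD; apply: eq_avg => g _ /=; rewrite -natrD.
by congr _%:R; case: ltngtP; lia.
Qed.

Lemma sum_freq_leq K : \sum_(j < K) cdf j = avg A (fun g => (K - Z g)%:R).
Proof.
under eq_bigr => j _ do rewrite freq_avg.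
rewrite -avg_sum; apply: eq_avg => g _ /=; rewrite -natr_sum; congr _%:R.
elim: K => [|K IHK]; first by rewrite big_ord0.
by rewrite big_ord_recr /= IHK; case: leqP; lia.
Qed.

Hypothesis Z_log_concave : log_concave_law A Z.

Lemma freq_leq_nd : {homo (fun j => cdf j) : i j / (i <= j)%N >-> i <= j}.
Proof. by move=> i j ij; apply: ler_freq => g _ /leq_trans; apply. Qed.

Lemma freq_leq_log_concave : log_concave (fun j => cdf j).
Proof.
move=> j.
rewrite /freq expr2 [X in X <= _]mulrACA [X in _ <= X]mulrACA.
rewrite ler_wpM2r ?mulr_ge0 ?invr_ge0 //.
by rewrite -!natrM ler_nat mulnn.
Qed.

Lemma freq_eq_avg_subn_le1 k : mass k * avg A (fun g => (k - Z g)%:R) <= 1.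
Proof.
case: k => [|k].
  by rewrite (_ : avg _ _ = 0) ?mulr0 // /avg big1 ?mul0r // => g _.
rewrite -sum_freq_leq.
have := log_concave_sum_le (fun j => freq_ge0 R A _) freq_leq_nd
  freq_leq_log_concave (leqnn k.+1).
rewrite freq_leqS addrAC subrr add0r -freq_leqS => /le_trans; apply.
by rewrite mulr_ile1 ?freq_ge0 ?freq_le1.
Qed.

End LogConcaveLaw.

Section LogConcaveLawGrunbaum.
Variables (R : realType) (T : finType) (A : {set T}) (Z : T -> nat).
Hypothesis A_gt0 : (0 < #|A|)%N.
Hypothesis Z_log_concave : log_concave_law A Z.
Local Notation cdf j := (freq R A (fun g => Z g <= j)%N).
Local Notation mass j := (freq R A (fun g => Z g == j)).

Lemma grunbaum_freq_leq K : avg A (fun g => (Z g)%:R) <= K%:R :> R ->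
  (expR 1)^-1 <= cdf K + expR 1 * mass K.+1.
Proof.
move=> mean_le.
have mean_bound l : l%:R <= \sum_(j < K + l) cdf j.
  rewrite sum_freq_leq.
  have : (K + l)%:R <= avg A (fun g => (K + l - Z g)%:R + (Z g)%:R) :> R.
    rewrite -[leLHS](avg_cst _ A_gt0); apply: ler_avg => g _.
    by rewrite -natrD ler_nat; lia.
  by rewrite avgD natrD; lra.
have := log_concave_grunbaum (fun j => freq_ge0 R A _) (@freq_leq_nd R _ A Z)
  (freq_leq_log_concave R Z_log_concave) mean_bound.
by rewrite freq_leqS [in X in _ * X]addrC addKr.
Qed.

Lemma grunbaum_freq_ltn M k p :
    (forall j, mass j <= p) -> avg A (fun g => (Z g)%:R) <= (M + k)%:R :> R ->
  (expR 1)^-1 <= freq R A (fun g => Z g < M)%N + (expR 1 + k.+1%:R) * p.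
Proof.
move=> mass_le mean_le; apply: le_trans (grunbaum_freq_leq mean_le) _.
have mass_e : expR 1 * mass (M + k).+1 <= expR 1 * p.
  by rewrite ler_pM2l ?expR_gt0.
suff : cdf (M + k) <= freq R A (fun g => Z g < M)%N + k.+1%:R * p by lra.
elim: k {mean_le mass_e} => [|k IHk].
  rewrite addn0 mul1r; apply: le_trans (lerD (lexx _) (mass_le M)).
  rewrite !freq_avg -avgD; apply: ler_avg => g _ /=.
  by rewrite -natrD ler_nat; case: ltngtP.
rewrite addnS freq_leqS -[k.+2%:R]natr1; have := mass_le (M + k).+1; lra.
Qed.

End LogConcaveLawGrunbaum.

Lemma val_ord_min N (i j : 'I_N) : Order.min i j = minn i j :> nat.
Proof. by rewrite /Order.min ltEord; case: ifP; lia. Qed.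

Lemma val_ord_max N (i j : 'I_N) : Order.max i j = maxn i j :> nat.
Proof. by rewrite /Order.max ltEord; case: ifP; lia. Qed.

Section MonotoneMaps.
Local Open Scope nat_scope.
Context {d : Order.disp_t} {P : finPOrderType d}.
Variable m : nat.
Implicit Types (g h : {ffun P -> 'I_m.+1}) (x y z : P).

Definition monotone_maps : {set {ffun P -> 'I_m.+1}} :=
  [set g : {ffun P -> 'I_m.+1} |
    [forall x, forall y, (x <= y)%O ==> (g x <= g y)]].

Lemma monotone_mapsP g :
  reflect {homo g : x y / (x <= y)%O >-> x <= y} (g \in monotone_maps).
Proof.
rewrite inE; apply: (iffP 'forall_forallP) => homo_g x y; first exact/implyP.
exact/implyP/homo_g.
Qed.

Lemma card_monotone_maps_gt0 : 0 < #|monotone_maps|.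
Proof.
apply/card_gt0P; exists [ffun=> ord0]; apply/monotone_mapsP => x y _.
by rewrite !ffunE.
Qed.

Lemma leq_ffun_ord g x : g x <= m.
Proof. by rewrite -ltnS ltn_ord. Qed.

(* The difference [g y - g x], shifted by [m] to be a natural number. *)
Definition diff x y g : nat := m + g y - g x.

Lemma diff_rev x y g : diff y x g = m + m - diff x y g.
Proof.
by rewrite /diff; have := leq_ffun_ord g x; have := leq_ffun_ord g y; lia.
Qed.

Lemma diff_le_max x y g : diff x y g <= m + m.
Proof. by rewrite /diff; have := leq_ffun_ord g y; lia. Qed.

Lemma diff_lt x y g : (diff x y g < m) = (g y < g x).
Proof. by rewrite /diff; have := leq_ffun_ord g x; lia. Qed.

Section Bands.
Variables x y : P.
Local Notation coords := {ffun option P -> 'I_(m + m).+2}.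
Implicit Type c : coords.

(* The translate of [g] that takes the value [b] at [x], together with the
   image of 0 under the translation as the value at [None]. In these
   coordinates, monotonicity, the bounds 0 and [m] and an upper bound on
   [g y - g x] are all preserved by pointwise minima and maxima. *)
Definition translate b g : coords :=
  [ffun u => inord (if u is Some i then b + g i - g x else b - g x)].

Definition band b k : {set coords} :=
  [set c : coords |
    [&& [forall i, forall j, (i <= j)%O ==> (c (Some i) <= c (Some j))],
        [forall i, c None <= c (Some i) <= c None + m],
        c (Some x) == b :> nat & c (Some y) <= k]].

Lemma bandP b k c :
  reflect [/\ {homo (fun i => c (Some i)) : i j / (i <= j)%O >-> i <= j},
              forall i, c None <= c (Some i) <= c None + m,
              c (Some x) = b :> nat & c (Some y) <= k]
          (c \in band b k).
Proof.
rewrite inE; apply: (iffP and4P).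
  case=> /'forall_forallP homo_c /forallP c_bounds /eqP cx cy; split=> // i j.
  exact/implyP.
case=> homo_c c_bounds cx cy; split=> //; last exact/eqP.
  by apply/'forall_forallP => i j; apply/implyP/homo_c.
exact/forallP.
Qed.

Lemma band_min_max b b' k k' c c' : c \in band b k -> c' \in band b' k' ->
  ffun_min c c' \in band (minn b b') (minn k k') /\
  ffun_max c c' \in band (maxn b b') (maxn k k').
Proof.
move=> /bandP[/= homo_c c_bounds cx cy] /bandP[/= homo_c' c'_bounds c'x c'y].
by split; apply/bandP;
  (split=> [i j ij|i||]; rewrite !ffunE !(val_ord_min, val_ord_max) /=;
    [have /= := homo_c i j ij; have /= := homo_c' i j ij
    |have := c_bounds i; have := c'_bounds i | |]; lia).
Qed.

Section Translates.
Variable b : nat.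
Hypothesis b_bounds : m <= b <= m.+1.

Lemma translateE g u :
  translate b g u = (if u is Some i then b + g i - g x else b - g x) :> nat.
Proof.
rewrite ffunE inordK //; case: u => [i|]; last by lia.
by have := leq_ffun_ord g i; lia.
Qed.

Lemma translate_inj : injective (translate b).
Proof.
move=> g h eq_gh; have eq_at u := congr1 (fun c : coords => c u : nat) eq_gh.
have := eq_at None; rewrite /= !translateE => eq_x.
have := leq_ffun_ord g x; have := leq_ffun_ord h x => hx gx.
apply/ffunP => i; apply: val_inj; have := eq_at (Some i).
by rewrite /= !translateE; lia.
Qed.

Lemma card_band k j : k + m = b + j ->
  #|band b k| = #|[set g in monotone_maps | diff x y g <= j]|.
Proof.
move=> kj; rewrite -(card_imset _ translate_inj); apply: eq_card => c.
apply/bandP/imsetP => [[/= homo_c c_bounds cx cy]|[g /setIdP[]]].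
  pose g : {ffun P -> 'I_m.+1} := [ffun i => inord (c (Some i) - c None)].
  have /= gE i : g i = c (Some i) - c None :> nat.
    by rewrite ffunE inordK //=; have := c_bounds i; lia.
  exists g.
    apply/setIdP; split.
      by apply/monotone_mapsP => i j' /homo_c; rewrite !gE /=; lia.
    by rewrite /diff !gE; have := c_bounds x; have := c_bounds y; lia.
  apply/ffunP => -[i|]; apply: val_inj; rewrite /= translateE !gE.
    by have := c_bounds x; have := c_bounds i; lia.
  by have := c_bounds x; lia.
move=> /monotone_mapsP homo_g; rewrite /diff => g_diff ->.
have gx := leq_ffun_ord g x.
split=> [i i' /homo_g|i||]; rewrite !translateE; try lia.
by have := leq_ffun_ord g i; lia.
Qed.

End Translates.

Lemma diff_log_concave : log_concave_law monotone_maps (diff x y).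
Proof.
move=> j; have low : m <= m <= m.+1 by lia.
have high : m <= m.+1 <= m.+1 by lia.
rewrite -(card_band high (_ : j.+1 + m = m.+1 + j)); last by lia.
rewrite -(card_band low (_ : j.+2 + m = m + j.+2)); last by lia.
rewrite -mulnn -{1}(card_band low (_ : j.+1 + m = m + j.+1)); last by lia.
rewrite -(card_band high (_ : j.+2 + m = m.+1 + j.+1)); last by lia.
apply: four_functions_card => c c' c_band c'_band.
have := band_min_max c_band c'_band.
by rewrite (minn_idPr (leqnSn m)) (maxn_idPl (leqnSn m)) minnC maxnC
  (minn_idPr (leqnSn j.+1)) (maxn_idPl (leqnSn j.+1)).
Qed.

End Bands.
End MonotoneMaps.

Section NatBigMin.
Local Open Scope nat_scope.
Variables (I : finType) (Q : pred I) (F : I -> nat) (a : nat).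

Lemma leq_bigmin k :
  reflect (k <= a /\ forall i, Q i -> k <= F i)
          (k <= \big[minn/a]_(i | Q i) F i).
Proof. by rewrite -minEnat -leEnat; apply: bigmin_geP. Qed.

Lemma bigmin_leq_id : \big[minn/a]_(i | Q i) F i <= a.
Proof. by rewrite -minEnat -leEnat bigmin_le_id. Qed.

Lemma bigmin_leq_cond i : Q i -> \big[minn/a]_(i | Q i) F i <= F i.
Proof. by rewrite -minEnat -leEnat; apply: bigmin_le_cond. Qed.

End NatBigMin.

Section Windows.
Local Open Scope nat_scope.
Context {d : Order.disp_t} {P : finPOrderType d}.
Variable m : nat.
Implicit Types (g h : {ffun P -> 'I_m.+1}) (x y z : P).
Local Notation Om := (@monotone_maps d P m).

Definition window_lo g x : nat := \max_(z | (z < x)%O) g z.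
Definition window_hi g x : nat := \big[minn/m]_(z | (x < z)%O) g z.
Definition window_width g x : nat := window_hi g x - window_lo g x.

Lemma window_width_le g x : window_width g x <= m.
Proof. exact: leq_trans (leq_subr _ _) (bigmin_leq_id _ _ _). Qed.

Lemma window_lo_hi g x : g \in Om -> window_lo g x <= g x <= window_hi g x.
Proof.
move/monotone_mapsP=> homo_g; apply/andP; split.
  by apply/bigmax_leqP => z /ltW/homo_g.
by apply/leq_bigmin; split=> [|z /ltW/homo_g //]; apply: leq_ffun_ord.
Qed.

Lemma eq_window g h x : (forall z, z != x -> g z = h z) ->
  (window_lo g x = window_lo h x) * (window_hi g x = window_hi h x).
Proof.
move=> eq_gh; split; apply: eq_bigr => z; rewrite lt_neqAle => /andP[zx _].
  by rewrite eq_gh.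
by rewrite eq_gh // eq_sym.
Qed.

(* A cyclic move of [g x] by half of its window: it preserves the uniform
   distribution and displaces [g x] by at least half of the width. *)
Definition rotate_val x g : nat :=
  let b := g x + uphalf (window_width g x) in
  if b <= window_hi g x then b else b - (window_width g x).+1.
Definition rotate x g : {ffun P -> 'I_m.+1} :=
  [ffun z => if z == x then inord (rotate_val x g) else g z].

Lemma rotate_val_bounds x g : g \in Om ->
  window_lo g x <= rotate_val x g <= window_hi g x.
Proof.
by move/(window_lo_hi x); rewrite /rotate_val /window_width; case: ifP; lia.
Qed.

Lemma rotate_at x g : g \in Om -> rotate x g x = rotate_val x g :> nat.
Proof.
move=> gO; rewrite ffunE eqxx inordK // ltnS.
have /andP[_ /leq_trans->] := rotate_val_bounds x gO => //.
exact: bigmin_leq_id.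
Qed.

Lemma rotate_neq x g z : z != x -> rotate x g z = g z.
Proof. by move=> zx; rewrite ffunE (negPf zx). Qed.

Lemma rotate_displacement x g : g \in Om ->
  window_width g x <= 2 * `|rotate x g x - g x|.
Proof.
move=> gO; rewrite rotate_at //; have := window_lo_hi x gO.
by rewrite /rotate_val /window_width; case: ifP; lia.
Qed.

Lemma rotate_mem x g : g \in Om -> rotate x g \in Om.
Proof.
move=> gO; have /monotone_mapsP homo_g := gO; apply/monotone_mapsP => u v.
have /andP[lo hi] := rotate_val_bounds x gO; rewrite le_eqVlt.
case/predU1P=> [-> //|uv]; have [ux|ux] := eqVneq u x.
  have vx : v != x by rewrite -ux gt_eqF.
  rewrite ux rotate_at // rotate_neq //; apply: leq_trans hi _.
  by apply: bigmin_leq_cond; rewrite -ux.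
rewrite rotate_neq //; have [vx|vx] := eqVneq v x.
  rewrite vx rotate_at //; apply: leq_trans lo.
  by apply: (@leq_bigmax_cond _ _ (fun z => g z : nat)); rewrite -vx.
by rewrite rotate_neq // homo_g // ltW.
Qed.

Lemma rotate_inj x : {in Om &, injective (rotate x)}.
Proof.
move=> g h gO hO eq_rot.
have eq_off z : z != x -> g z = h z.
  by move=> zx; rewrite -(rotate_neq g zx) eq_rot rotate_neq.
have [lo hi] := eq_window eq_off; apply/ffunP => z; apply: val_inj => /=.
have [->|/eq_off -> //] := eqVneq z x.
have := congr1 (fun f : {ffun P -> 'I_m.+1} => f x : nat) eq_rot.
rewrite /= !rotate_at // /rotate_val /window_width lo hi.
have := window_lo_hi x gO; have := window_lo_hi x hO; rewrite lo hi.
by case: ifP; case: ifP; lia.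
Qed.

End Windows.

Section PointMass.
Context {d : Order.disp_t} {P : finPOrderType d} (R : realFieldType).
Variable m : nat.
Implicit Types (g : {ffun P -> 'I_m.+1}) (x y : P) (k : nat).
Local Notation Om := (@monotone_maps d P m).

Definition mean_value x : R := avg Om (fun g => (g x)%:R).
Definition mean_width x : R := avg Om (fun g => (window_width g x)%:R).
Definition mean_dist x y k : R :=
  avg Om (fun g => `|diff x y g - k|%N%:R).
Local Notation diff_mass x y k := (freq R Om (fun g => diff x y g == k)).

Lemma mean_value_ge0 x : 0 <= mean_value x.
Proof. by apply: avg_ge0. Qed.

Lemma mean_value_le x : mean_value x <= m%:R.
Proof.
rewrite -(avg_cst m%:R (card_monotone_maps_gt0 m (P := P))).
by apply: ler_avg => g _; rewrite ler_nat leq_ffun_ord.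
Qed.

Lemma mean_width_le x : mean_width x <= m%:R.
Proof.
rewrite -(avg_cst m%:R (card_monotone_maps_gt0 m (P := P))).
by apply: ler_avg => g _; rewrite ler_nat window_width_le.
Qed.

Lemma diff_mass_gt x y k : (m + m < k)%N -> diff_mass x y k = 0.
Proof.
move=> k_gt; rewrite freq_avg /avg big1 ?mul0r // => g _.
by have := diff_le_max x y g; case: eqP => // ->; rewrite leqNgt k_gt.
Qed.

Lemma diff_mass_rev x y k :
  (k <= m + m)%N -> diff_mass x y k = diff_mass y x (m + m - k)%N.
Proof.
move=> k_le; rewrite !freq_avg; apply: eq_avg => g _; rewrite (diff_rev x y).
by congr (nat_of_bool _)%:R; have := diff_le_max x y g; lia.
Qed.

Lemma diff_mass_mean_dist x y k : diff_mass x y k * mean_dist x y k <= 2.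
Proof.
have [k_gt|k_le] := ltnP (m + m) k; first by rewrite diff_mass_gt // mul0r.
have -> : mean_dist x y k = avg Om (fun g => (k - diff x y g)%:R) +
    avg Om (fun g => (m + m - k - diff y x g)%:R).
  rewrite -avgD; apply: eq_avg => g _ /=; rewrite -natrD; congr _%:R.
  by rewrite (diff_rev x y); have := diff_le_max x y g; lia.
rewrite mulrDr {2}(diff_mass_rev _ _ k_le).
have := freq_eq_avg_subn_le1 R (diff_log_concave m x y) k.
have := freq_eq_avg_subn_le1 R (diff_log_concave m y x) (m + m - k)%N.
lra.
Qed.

Lemma avg_rotate x (Z : {ffun P -> 'I_m.+1} -> R) :
  avg Om (fun g => Z (rotate x g)) = avg Om Z.
Proof.
rewrite /avg -(big_imset Z (@rotate_inj _ _ m x)) /=; congr (_ / _).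
apply: eq_bigl; apply/subset_cardP.
  by rewrite card_in_imset //; apply: rotate_inj.
by apply/subsetP => _ /imsetP[g gO ->]; apply: rotate_mem.
Qed.

Lemma mean_width_le_dist x y k : x != y ->
  mean_width x <= 4 * mean_dist x y k.
Proof.
move=> xy; pose dist g : R := `|diff x y g - k|%N%:R.
apply: (@le_trans _ _ (avg Om (fun g => 2 * (dist (rotate x g) + dist g))));
  last by rewrite avgMl avgD avg_rotate -/(mean_dist x y k); lra.
apply: ler_avg => g gO; rewrite /dist -natrD -natrM ler_nat.
apply: leq_trans (rotate_displacement x gO) _.
rewrite leq_mul2l /diff (@rotate_neq _ _ _ _ _ y) 1?eq_sym //=.
by have := leq_ffun_ord g x; have := leq_ffun_ord (rotate x g) x; lia.
Qed.

Lemma diff_mass_mean_width x y k :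
  x != y -> diff_mass x y k * mean_width x <= 8.
Proof.
move=> xy; have := diff_mass_mean_dist x y k.
have := ler_wpM2l (freq_ge0 R Om (fun g => diff x y g == k))
  (mean_width_le_dist k xy); lra.
Qed.

Lemma diff_mass_mean_widthC x y k :
  x != y -> diff_mass y x k * mean_width x <= 8.
Proof.
move=> xy; have [k_gt|k_le] := ltnP (m + m) k.
  by rewrite diff_mass_gt // mul0r.
by rewrite diff_mass_rev // diff_mass_mean_width.
Qed.

End PointMass.

Section MeanDifference.
Context {d : Order.disp_t} {P : finPOrderType d} (R : realType).
Variable m : nat.
Implicit Types (g : {ffun P -> 'I_m.+1}) (x y : P).
Local Notation Om := (@monotone_maps d P m).

Lemma grunbaum_freq_lt x y (eta w : R) :
    0 < w -> 0 <= eta ->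
    (forall k : nat, freq R Om (fun g => diff x y g == k) * w <= 8) ->
    mean_value R m y - mean_value R m x <= eta * w ->
  (expR 1)^-1 <= freq R Om (fun g => g y < g x)%N +
    (8 * (expR 1 + 2) / w + 8 * eta).
Proof.
move=> w_gt0 eta_ge0 mass_le mean_le.
pose k := (Num.truncn (eta * w)).+1.
have k_gt : eta * w < k%:R by rewrite truncnS_gt.
have k_le : k%:R <= eta * w + 1.
  by rewrite -natr1 lerD2r truncn_le // mulr_ge0 // ltW.
have mean_diff : avg Om (fun g => (diff x y g)%:R) <= (m + k)%:R :> R.
  rewrite (eq_avg (Z := fun g => m%:R + (g y)%:R - (g x)%:R)) => [|g _] /=.
    rewrite avgB avgD (avg_cst _ (card_monotone_maps_gt0 m (P := P))) natrD.
    rewrite -/(mean_value R m x) -/(mean_value R m y); lra.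
  by rewrite natrB ?natrD // (leq_trans (leq_ffun_ord g x)) ?leq_addr.
have mass_le_div (j : nat) : freq R Om (fun g => diff x y g == j) <= 8 / w.
  by rewrite ler_pdivlMr.
apply: le_trans (grunbaum_freq_ltn (card_monotone_maps_gt0 m)
  (diff_log_concave m x y) mass_le_div mean_diff) _.
apply: lerD; first by apply: ler_freq => g _; rewrite diff_lt.
have -> : 8 * (expR 1 + 2) / w + 8 * eta =
    (expR 1 + (eta * w + 2)) * (8 / w).
  by field; rewrite gt_eqF.
by rewrite ler_wpM2r ?divr_ge0 ?(ltW w_gt0) // lerD2l -natr1; lra.
Qed.

End MeanDifference.

Section LinearExtensions.
Local Open Scope nat_scope.
Context {d : Order.disp_t} {P : finPOrderType d}.
Local Notation n := #|P|.
Implicit Types (x y z : P) (f : {ffun P -> 'I_n}) (kappa : P -> nat).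

Lemma linext_inj f : f \in linexts -> injective f.
Proof. by rewrite inE => /is_linextP[/bij_inj]. Qed.

Lemma linext_homo f :
  f \in linexts -> {homo f : x y / (x < y)%O >-> x < y}.
Proof.
move=> fL x y xy; have f_inj := linext_inj fL.
move: fL; rewrite inE => /is_linextP[_ homo_f].
rewrite ltn_neqAle homo_f ?ltW // andbT.
by apply: contraTneq xy => /val_inj/f_inj ->; rewrite ltxx.
Qed.

Lemma linext_onto f (k : 'I_n) : f \in linexts -> exists x, f x = k.
Proof. by rewrite inE => /is_linextP[[g _ gK] _]; exists (g k). Qed.

Lemma card_linext_below f x : f \in linexts -> #|[set y | f y < f x]| = f x.
Proof.
rewrite inE => /is_linextP[f_bij _].
rewrite (_ : [set y | _] = f @^-1: [set k : 'I_n | k < f x]); last first.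
  by apply/setP => y; rewrite !inE.
rewrite on_card_preimset; last by apply: onW_bij.
rewrite -sum1dep_card -(big_ord_widen n (fun=> 1)) ?sum1_card ?card_ord //.
exact: ltnW.
Qed.

Lemma eq_linext f f' : f \in linexts -> f' \in linexts ->
  (forall x y, (f x < f y) = (f' x < f' y)) -> f = f'.
Proof.
move=> fL f'L eq_ff'; apply/ffunP => x; apply: val_inj => /=.
rewrite -(card_linext_below x fL) -(card_linext_below x f'L).
by apply: eq_card => y; rewrite !inE eq_ff'.
Qed.

Lemma lower_lt_pos f x : f \in linexts -> lower f x < pos f x.
Proof.
by move=> fL; rewrite /pos ltnS; apply/bigmax_leqP => z; apply: linext_homo.
Qed.

Lemma pos_lt_upper f x : f \in linexts -> pos f x < upper f x.
Proof.
move=> fL; apply/leq_bigmin; split; first by rewrite /pos ltnS ltn_ord.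
by move=> z /(linext_homo fL).
Qed.

Lemma lower_lt_upper f x : f \in linexts -> (lower f x).+1 < upper f x.
Proof.
by move=> fL; apply: leq_ltn_trans (lower_lt_pos x fL) (pos_lt_upper x fL).
Qed.

Lemma card_sublevel_lt kappa x :
  #|[set y | kappa y < kappa x]| < n.
Proof.
rewrite -cardsT; apply/proper_card/properP; split; first exact: subsetT.
by exists x; rewrite !inE ?ltnn.
Qed.

Definition rank kappa : {ffun P -> 'I_n} :=
  [ffun x => Ordinal (card_sublevel_lt kappa x)].

Lemma rankE kappa x : rank kappa x = #|[set y | kappa y < kappa x]| :> nat.
Proof. by rewrite ffunE. Qed.

Lemma rank_homo kappa x y : kappa x < kappa y -> rank kappa x < rank kappa y.
Proof.
move=> xy; rewrite !rankE; apply/proper_card/properP; split.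
  by apply/subsetP => z; rewrite !inE => /ltn_trans; apply.
by exists x; rewrite !inE ?ltnn.
Qed.

Lemma rank_linext kappa : injective kappa ->
  {homo kappa : x y / (x <= y)%O >-> x <= y} -> rank kappa \in linexts.
Proof.
move=> kappa_inj homo_kappa; rewrite inE; apply/is_linextP; split.
  apply: inj_card_bij; last by rewrite card_ord.
  move=> x y eq_rank; apply: kappa_inj.
  by case: (ltngtP (kappa x) (kappa y)) => // /rank_homo; rewrite eq_rank ltnn.
move=> x y /homo_kappa; rewrite leq_eqVlt => /predU1P[/kappa_inj -> //|].
by move/rank_homo/ltnW.
Qed.

Lemma card_linexts_gt0 : 0 < #|@linexts d P|.
Proof.
pose down x := #|[set y | (y <= x)%O]|.
have down_homo : {homo down : x y / (x < y)%O >-> x < y}.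
  move=> x y xy; apply/proper_card/properP; split.
    by apply/subsetP => z; rewrite !inE => /le_trans; apply; apply: ltW.
  by exists y; rewrite !inE ?lexx // lt_geF.
apply/card_gt0P; exists (rank (fun x => down x * n + enum_rank x)).
apply: rank_linext => [x y /(congr1 (modn^~ n))|x y].
  by rewrite !modnMDl !modn_small // => /val_inj/enum_rank_inj.
rewrite le_eqVlt => /predU1P[-> //|/down_homo xy]; apply: ltnW.
apply: leq_trans (leq_addr _ _); apply: (@leq_trans ((down x).+1 * n)).
  by rewrite mulSn addnC ltn_add2r.
by rewrite leq_mul2r xy orbT.
Qed.

End LinearExtensions.

Section WinBounds.
Context {d : Order.disp_t} {P : finPOrderType d} (R : realType).
Implicit Type x : P.

Lemma win_avg x : win R x = avg linexts (fun f => (upper f x - lower f x)%:R).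
Proof.
apply: eq_avg => f fL /=; rewrite natrB //.
by apply: ltnW; apply: ltnW; apply: lower_lt_upper.
Qed.

Lemma win_ge2 x : 2 <= win R x.
Proof.
rewrite win_avg -(avg_cst 2 (card_linexts_gt0 (P := P))).
by apply: ler_avg => f fL; rewrite ler_nat; have := lower_lt_upper x fL; lia.
Qed.

Lemma win_ge0 x : 0 <= win R x.
Proof. exact: le_trans (win_ge2 x). Qed.

End WinBounds.

Section Counting.
Local Open Scope nat_scope.
Implicit Types n N : nat.

Lemma expn_sub_ffact_le N n : (N ^ n - N ^_ n) * N <= n ^ 2 * N ^ n.
Proof.
elim: n => [|n IHn]; first by rewrite subnn.
have ffact_le : N ^_ n <= N ^ n.
  rewrite ffact_prod -[n in N ^ n]card_ord -prod_nat_const.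
  by apply: leq_prod => i _; apply: leq_subr.
have step_le : N ^ n * N - N ^_ n * (N - n) <= (N ^ n - N ^_ n) * N + N ^ n * n.
  rewrite mulnBl mulnBr; have := leq_mul ffact_le (leqnn n); lia.
rewrite ffactnSr expnSr; apply: leq_trans (leq_mul step_le (leqnn N)) _.
have := leq_mul IHn (leqnn N); rewrite mulnDl; nia.
Qed.

Lemma expn_le_bin N n : n <= N -> N ^ n <= n ^ n * 'C(N, n).
Proof.
move=> nN; rewrite -(leq_pmul2r (fact_gt0 n)) -mulnA bin_ffact mulnC.
have expn_prod k : k ^ n = \prod_(i < n) k by rewrite prod_nat_const card_ord.
rewrite -ffactnn !ffact_prod !expn_prod -!big_split /=.
by apply: leq_prod => i _; have := ltn_ord i; rewrite mulnBr mulnBl; nia.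
Qed.

Lemma card_below_inj N (S : {set 'I_N}) :
  {in S &, injective (fun k : 'I_N => #|[set l in S | l < k]|)}.
Proof.
have below_homo (k l : 'I_N) : k \in S -> k < l ->
    #|[set i in S | i < k]| < #|[set i in S | i < l]|.
  move=> kS kl; apply/proper_card/properP; split.
    apply/subsetP => i /setIdP[iS ik]; apply/setIdP; split=> //.
    exact: ltn_trans kl.
  by exists k; rewrite !inE kS ?ltnn.
move=> k l kS lS eq_below; apply: val_inj.
case: (ltngtP k l) => [/(below_homo k l kS)|/(below_homo l k lS)|//].
  by rewrite eq_below ltnn.
by rewrite eq_below ltnn.
Qed.

End Counting.

Section InjectiveMonotoneMaps.
Local Open Scope nat_scope.
Context {d : Order.disp_t} {P : finPOrderType d}.
Variable m : nat.
Local Notation n := #|P|.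
Local Notation Om := (@monotone_maps d P m).
Implicit Types (x y z : P) (g h : {ffun P -> 'I_m.+1}).

Lemma rank_monotone_linext g :
  g \in Om -> injective g -> rank (fun z => g z) \in linexts.
Proof.
move=> /monotone_mapsP homo_g g_inj.
by apply: rank_linext => // x y /val_inj/g_inj.
Qed.

Lemma rank_below g x : injective g ->
  rank (fun z => g z) x = #|[set k in g @: P | k < g x]| :> nat.
Proof.
move=> g_inj; rewrite rankE -(card_imset _ g_inj); apply: eq_card => k.
apply/imsetP/setIdP => [[z + ->]|[/imsetP[z _ ->] gz]].
  by rewrite inE => gz; split=> //; apply: imset_f.
by exists z; rewrite ?inE.
Qed.

Lemma eq_rank_image g h : injective g -> injective h ->
  rank (fun z => g z) = rank (fun z => h z) -> g @: P = h @: P -> g = h.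
Proof.
move=> g_inj h_inj eq_rank eq_im; apply/ffunP => x.
apply: (@card_below_inj _ (g @: P)); first exact: imset_f.
  by rewrite eq_im imset_f.
by rewrite -rank_below // eq_im -rank_below // eq_rank.
Qed.

Lemma card_injective_rank_le (L : {set {ffun P -> 'I_n}}) :
  #|[set g : {ffun P -> 'I_m.+1} | injectiveb g & rank (fun z => g z) \in L]|
    <= #|L| * 'C(m.+1, n).
Proof.
rewrite -[in 'C(_, _)](card_ord m.+1) -card_draws -cardsX.
rewrite -(card_in_imset (f := fun g => (rank (fun z => g z), g @: P))).
  apply/subset_leq_card/subsetP => _ /imsetP[g /[!inE] /andP[g_inj gL] ->].
  by rewrite gL /= card_imset //; apply/injectiveP.
move=> g h /setIdP[/injectiveP g_inj _] /setIdP[/injectiveP h_inj _].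
by case; apply: eq_rank_image.
Qed.

Lemma card_noninjective_le :
  #|[set g : {ffun P -> 'I_m.+1} | ~~ injectiveb g]| * m.+1 <=
  n ^ 2 * m.+1 ^ n.
Proof.
apply: leq_trans (expn_sub_ffact_le m.+1 n); apply: leq_mul => //.
have := cardsC [set g : {ffun P -> 'I_m.+1} | injectiveb g].
rewrite card_inj_ffuns card_ffun card_ord => <-; rewrite addKn.
by apply/eq_leq/eq_card => g; rewrite !inE.
Qed.

End InjectiveMonotoneMaps.

Section Gaps.
Variables n s : nat.
Implicit Types (t : n.+1.-tuple 'I_s.+1) (i j k : nat).

Definition gaps : {set n.+1.-tuple 'I_s.+1} :=
  [set t : n.+1.-tuple 'I_s.+1 | (\sum_(i <- t) i)%N == s].

Definition gap t i : nat := nth ord0 t i.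

(* The gaps [t] separate the consecutive terms of an increasing sequence of [n]
   values in {0, ..., n + s - 1}, with virtual terms -1 and n + s at the
   positions 0 and [n.+1]: the term at position [j] is [gap_pos t j - 1]. *)
Definition gap_pos t j : nat := (\sum_(0 <= i < j) gap t i + j)%N.

Lemma sum_gap t : t \in gaps -> (\sum_(0 <= i < n.+1) gap t i)%N = s.
Proof. by rewrite inE (big_nth ord0) size_tuple => /eqP. Qed.

Lemma gap_pos0 t : gap_pos t 0 = 0%N.
Proof. by rewrite /gap_pos big_geq. Qed.

Lemma gap_pos_last t : t \in gaps -> gap_pos t n.+1 = (s + n).+1.
Proof. by move=> /sum_gap; rewrite /gap_pos addnS => ->. Qed.

Lemma gap_posD t j k : (j <= k)%N ->
  (gap_pos t k = gap_pos t j + \sum_(j <= i < k) gap t i + (k - j))%N.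
Proof.
move=> jk; rewrite /gap_pos (big_cat_nat (leq0n j) jk) /=.
by rewrite [RHS]addnAC -(addnA _ j) subnKC // addnAC.
Qed.

Lemma gap_pos_nd t j k : (j <= k)%N -> (gap_pos t j + (k - j) <= gap_pos t k)%N.
Proof. by move=> jk; rewrite (gap_posD t jk) leq_add2r leq_addr. Qed.

Lemma gap_pos_inj t t' :
  (forall j, (j <= n.+1)%N -> gap_pos t j = gap_pos t' j) -> t = t'.
Proof.
move=> eq_pos; apply: eq_from_tnth => i; apply: val_inj.
rewrite /= !(tnth_nth ord0) -/(gap t i) -/(gap t' i).
have := eq_pos i.+1 (ltn_ord i).
rewrite !(gap_posD _ (leqnSn i)) (eq_pos i (ltnW (ltn_ord i))) !big_nat1.
by move/addIn/addnI.
Qed.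

Lemma card_gaps : #|gaps| = 'C(s + n, n).
Proof. by rewrite addnC; apply: card_ord_partitions. Qed.

Lemma avg_gap_exchange (R : realFieldType) (a b : 'I_n.+1) :
  avg gaps (fun t => (tnth t a)%:R) = avg gaps (fun t => (tnth t b)%:R) :> R.
Proof.
pose swap t := [tuple tnth t (tperm a b k) | k < n.+1].
have swapK : involutive swap.
  by move=> t; apply: eq_from_tnth => k; rewrite !tnth_mktuple tpermK.
rewrite /avg (reindex_inj (inv_inj swapK)) /=; congr (_ / _).
apply: eq_big => [t|t _]; last by rewrite tnth_mktuple tpermL.
rewrite !inE !big_tuple; congr (_ == _).
rewrite [RHS](reindex_inj (@perm_inj _ (tperm a b))) /=.
by apply: eq_bigr => k _; rewrite tnth_mktuple.
Qed.

Lemma avg_gap (R : realFieldType) i : (i <= n)%N ->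
  avg gaps (fun t => (gap t i)%:R) = s%:R / n.+1%:R :> R.
Proof.
have gaps_gt0 : (0 < #|gaps|)%N by rewrite card_gaps bin_gt0 leq_addl.
rewrite -ltnS => lt_in; pose a := Ordinal lt_in.
have -> : avg gaps (fun t => (gap t i)%:R) =
    avg gaps (fun t => (tnth t a)%:R) :> R.
  by apply: eq_avg => t _ /=; rewrite (tnth_nth ord0).
rewrite -[s%:R](avg_cst _ gaps_gt0).
have -> : avg gaps (fun=> s%:R) =
    \sum_(b < n.+1) avg gaps (fun t => (tnth t b)%:R) :> R.
  rewrite -avg_sum; apply: eq_avg => t /[!inE] /eqP sum_t /=.
  by rewrite -natr_sum; congr _%:R; rewrite -[LHS]sum_t big_tuple.
rewrite (eq_bigr _ (fun b _ => avg_gap_exchange R b a)) sumr_const card_ord.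
by rewrite -[X in X / _]mulr_natr mulfK // pnatr_eq0.
Qed.

End Gaps.

Section GapMaps.
Local Open Scope nat_scope.
Context {d : Order.disp_t} {P : finPOrderType d}.
Variable r : nat.
Local Notation n := #|P|.
Local Notation m := (r + n).
Local Notation Om := (@monotone_maps d P m).
Local Notation gaps := (gaps n r.+1).
Implicit Types (x y z : P) (f : {ffun P -> 'I_n}) (t : n.+1.-tuple 'I_r.+2).

Definition gap_map f t : {ffun P -> 'I_m.+1} :=
  [ffun x => inord (gap_pos t (pos f x)).-1].

Lemma gap_mapE f t x : t \in gaps ->
  (gap_map f t x).+1 = gap_pos t (pos f x) :> nat.
Proof.
move=> tG; have := gap_pos_nd t (leq0n (pos f x)); rewrite gap_pos0 subn0.
have fx : pos f x <= n.+1 by rewrite /pos ltnS ltnW.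
have := gap_pos_nd t fx; rewrite gap_pos_last // => le_last ge_pos.
rewrite ffunE inordK; move: le_last ge_pos; rewrite /pos.
  by lia.
by have := ltn_ord (f x); lia.
Qed.

Lemma gap_map_ltn f t x y : t \in gaps ->
  (gap_map f t x < gap_map f t y) = (f x < f y).
Proof.
move=> tG.
have homo_map u v : f u < f v -> gap_map f t u < gap_map f t v.
  move=> uv; rewrite -ltnS !gap_mapE //.
  have /(gap_pos_nd t) : pos f u <= pos f v by rewrite /pos ltnS ltnW.
  by rewrite /pos; lia.
case: (ltngtP (f x) (f y)) => [/homo_map //|/homo_map|eq_f].
  by case: ltngtP.
by rewrite -ltnS !gap_mapE // /pos eq_f ltnn.
Qed.

Lemma gap_map_monotone f t :
  f \in linexts -> t \in gaps -> gap_map f t \in Om.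
Proof.
move=> fL tG; apply/monotone_mapsP => x y xy; rewrite leqNgt gap_map_ltn //.
by rewrite -leqNgt; move: fL; rewrite inE => /is_linextP[_]; apply.
Qed.

Lemma gap_map_inj :
  {in setX linexts gaps &, injective (fun u => gap_map u.1 u.2)}.
Proof.
move=> [f t] [f' t'] /setXP[/= fL tG] /setXP[/= f'L t'G] eq_map.
have eq_f : f = f'.
  apply: eq_linext => // x y.
  by rewrite -(gap_map_ltn _ _ _ tG) eq_map gap_map_ltn.
rewrite -{f'}eq_f in f'L eq_map *; congr (_, _).
apply: gap_pos_inj => -[|j]; first by rewrite !gap_pos0.
rewrite ltnS leq_eqVlt => /predU1P[->|jn]; first by rewrite !gap_pos_last.
have [x fx] := linext_onto (Ordinal jn) fL.
by have := gap_mapE f x tG; rewrite eq_map (gap_mapE f x t'G) /pos fx.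
Qed.

Lemma window_width_gap_map f t x : f \in linexts -> t \in gaps ->
  \sum_(lower f x <= i < upper f x) gap t i <= window_width (gap_map f t) x.
Proof.
move=> fL tG; have lu := lower_lt_upper x fL.
have /(gap_pos_nd t) : upper f x <= n.+1 by apply: bigmin_leq_id.
rewrite gap_pos_last // => up_last.
have hi_ge : gap_pos t (upper f x) - 2 <= window_hi (gap_map f t) x.
  apply/leq_bigmin; split=> [|z xz]; first by lia.
  have /(gap_pos_nd t) : upper f x <= pos f z by apply: bigmin_leq_cond.
  by rewrite -(gap_mapE f z tG); lia.
have lo_le : window_lo (gap_map f t) x <= gap_pos t (lower f x).
  apply/bigmax_leqP => z zx; apply: ltnW; rewrite gap_mapE //.
  have zl : pos f z <= lower f x by apply: (@leq_bigmax_cond _ _ (pos f)).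
  by apply: leq_trans (gap_pos_nd t zl); apply: leq_addr.
rewrite /window_width; have := gap_posD t (ltnW (ltnW lu)); lia.
Qed.

Lemma sum_gap_map_le (R : realFieldType) (F : {ffun P -> 'I_m.+1} -> R) :
    (forall g, 0 <= F g)%R ->
  (\sum_(f in linexts) \sum_(t in gaps) F (gap_map f t) <=
   \sum_(g in Om) F g)%R.
Proof.
move=> F_ge0; rewrite pair_big /=.
rewrite (eq_bigl (fun u => u \in setX linexts gaps)) => [|[f t]];
  last by rewrite in_setX.
rewrite -(big_imset F gap_map_inj) /=.
set im := [set _ | _ in _]; have im_sub : im \subset Om.
  apply/subsetP => _ /imsetP[[f t] /setXP[fL tG] ->].
  exact: gap_map_monotone.
by rewrite [leRHS](big_setID im) /= (setIidPr im_sub) lerDl sumr_ge0 // => g _.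
Qed.

Lemma card_linexts_gaps_le : #|@linexts d P| * #|gaps| <= #|Om|.
Proof.
rewrite -cardsX -(card_in_imset gap_map_inj).
apply/subset_leq_card/subsetP => _ /imsetP[[f t] /setXP[fL tG] ->].
exact: gap_map_monotone.
Qed.

Lemma card_gaps_bin : #|gaps| = 'C(m.+1, n).
Proof. by rewrite card_gaps addSn. Qed.

Lemma card_monotone_rank_in_le (L : {set {ffun P -> 'I_n}})
    (Q : pred {ffun P -> 'I_m.+1}) :
    (forall g, g \in Om -> injective g -> Q g -> rank (fun x => g x) \in L) ->
  #|[set g in Om | Q g]| <=
    #|L| * #|gaps| + #|[set g in Om | ~~ injectiveb g]|.
Proof.
move=> rank_in; pose ties := [set g : {ffun P -> 'I_m.+1} | ~~ injectiveb g].
rewrite card_gaps_bin [leqRHS]addnC -(cardsID ties) leq_add //.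
  by apply/subset_leq_card/subsetP => g; rewrite !inE -andbA => /and3P[-> _ ->].
apply: leq_trans (card_injective_rank_le _ _).
apply/subset_leq_card/subsetP => g.
rewrite !in_set negbK => /and3P[g_inj gO gQ].
by rewrite g_inj rank_in ?in_set //; apply/injectiveP.
Qed.

End GapMaps.

Section Comparison.
Context {d : Order.disp_t} {P : finPOrderType d} (R : realType).
Variable r : nat.
Local Notation n := #|P|.
Local Notation m := (r + n)%N.
Local Notation Om := (@monotone_maps d P m).
Local Notation L := (@linexts d P).
Local Notation gaps := (gaps n r.+1).
Implicit Types (x y : P) (g : {ffun P -> 'I_m.+1}).

Let L_gt0 : 0 < #|L|%:R :> R. Proof. by rewrite ltr0n card_linexts_gt0. Qed.
Let Om_gt0 : 0 < #|Om|%:R :> R.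
Proof. by rewrite ltr0n card_monotone_maps_gt0. Qed.

Definition tie_freq : R := freq R Om (fun g => ~~ injectiveb g).

Lemma tie_freq_le : tie_freq <= (n ^ n.+2)%:R / m.+1%:R.
Proof.
rewrite ler_pdivrMr // mulrAC ler_pdivlMr ?ltr0n // -!natrM ler_nat.
apply: (@leq_trans (n ^ 2 * m.+1 ^ n)%N).
  apply: leq_trans (card_noninjective_le m); apply: leq_mul => //.
  by apply/subset_leq_card/subsetP => g; rewrite !inE => /andP[].
have := card_linexts_gaps_le (P := P) r; rewrite card_gaps_bin => card_Om.
have bin_le : ('C(m.+1, n) <= #|Om|)%N.
  by apply: leq_trans card_Om; rewrite leq_pmull // card_linexts_gt0.
rewrite -(addn2 n) expnD mulnAC [leqRHS]mulnC leq_mul //.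
apply: leq_trans (expn_le_bin (leqW (leq_addl r n))) _.
by rewrite leq_mul.
Qed.

Lemma freq_lt_le_prob x y :
  freq R Om (fun g => g x < g y)%N <=
  prob R (fun f => pos f x < pos f y)%N + tie_freq.
Proof.
set Lxy := [set f in L | (pos f x < pos f y)%N].
have lt_rank g : g \in Om -> injective g -> (g x < g y)%N ->
    rank (fun z => g z) \in Lxy.
  move=> gO g_inj gxy; apply/setIdP; split; first exact: rank_monotone_linext.
  by rewrite /pos ltnS rank_homo.
have := card_monotone_rank_in_le lt_rank.
rewrite -(ler_nat R) natrD natrM => card_lt.
rewrite /freq ler_pdivrMr // (le_trans card_lt) // mulrDl divfK ?gt_eqF //.
rewrite lerD2r /prob mulrAC ler_pdivlMr // -mulrA ler_wpM2l //.
by rewrite mulrC -natrM ler_nat card_linexts_gaps_le.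
Qed.

Lemma avg_gap_map_width_ge f x : f \in L ->
  r.+1%:R / n.+1%:R * (upper f x - lower f x)%:R <=
  avg gaps (fun t => (window_width (gap_map f t) x)%:R) :> R.
Proof.
move=> fL; have up_le : (upper f x <= n.+1)%N by apply: bigmin_leq_id.
apply: le_trans (ler_avg (Y := fun t =>
    \sum_(lower f x <= i < upper f x) (gap t i)%:R) _) => [|t tG]; last first.
  by rewrite -natr_sum ler_nat window_width_gap_map.
rewrite avg_sum mulr_natr -sumr_const_nat le_eqVlt; apply/orP; left; apply/eqP.
by apply: eq_big_nat => i /andP[_ iu]; rewrite avg_gap // -ltnS (leq_trans iu).
Qed.

Lemma sum_window_width_ge x :
  #|gaps|%:R * #|L|%:R * (r.+1%:R / n.+1%:R * win R x) <=
  \sum_(g in Om) (window_width g x)%:R.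
Proof.
apply: le_trans (sum_gap_map_le (F := fun g => (window_width g x)%:R) _) => //.
rewrite mulrACA win_avg card_mul_avg mulr_sumr; apply: ler_sum => f fL.
by rewrite -mulrA -card_mul_avg ler_wpM2l // avg_gap_map_width_ge.
Qed.

Lemma mean_width_ge x :
  (1 - tie_freq) * (r.+1%:R / n.+1%:R * win R x) <=
  mean_width R m x.
Proof.
have scale_ge0 : 0 <= r.+1%:R / n.+1%:R * win R x.
  by apply: mulr_ge0; [exact: divr_ge0 | exact: win_ge0].
rewrite /mean_width ler_pdivlMr // (le_trans _ (sum_window_width_ge x)) //.
rewrite mulrAC ler_wpM2r // mulrBl mul1r divfK ?gt_eqF // lerBlDr.
rewrite -natrM -natrD ler_nat mulnC.
apply: leq_trans (card_monotone_rank_in_le (Q := predT) _) => [|g gO g_inj _].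
  by apply/subset_leq_card/subsetP => g gO; rewrite inE gO.
exact: rank_monotone_linext.
Qed.

End Comparison.

Lemma sum_disjoint_intervals_le (R : realDomainType) (T : finType)
    (a w : T -> R) (X : {set T}) (b : R) :
    0 <= b -> {in X, forall x, 0 <= a x} -> {in X, forall x, a x + w x <= b} ->
    {in X &, forall x y, x != y -> a x <= a y -> a x + w x <= a y} ->
  \sum_(x in X) w x <= b.
Proof.
move cardX: #|X| => k.
elim: k X b cardX => [|k IHk] X b cardX b_ge0 a_ge0 ub disj.
  by move/eqP: cardX; rewrite cards_eq0 => /eqP ->; rewrite big_set0.
have /card_gt0P[x0 x0X] : (0 < #|X|)%N by rewrite cardX.
case: (@arg_maxP _ _ _ x0 (fun x => x \in X) a x0X) => x xX a_max.
have := ub x xX; rewrite (big_setD1 x xX) /=.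
suff : \sum_(y in X :\ x) w y <= a x by lra.
apply: IHk; last by move=> y z /setD1P[_ yX] /setD1P[_ zX]; apply: disj.
- by move: cardX; rewrite (cardsD1 x) xX => -[].
- exact: a_ge0.
- by move=> y /setD1P[_]; apply: a_ge0.
- by move=> y /setD1P[yx yX]; apply: disj => //; apply: a_max.
Qed.

Section Balance.
Context {d : Order.disp_t} {P : finPOrderType d} (R : realType).
Local Notation n := #|P|.
Implicit Types (x y : P) (X : {set P}) (eta : R).

Lemma exists_close_means (m : nat) eta X : 0 <= eta ->
    (1 + eta) * m%:R < eta * \sum_(x in X) mean_width R m x ->
  exists x y, [/\ x \in X, y \in X, x != y &
    `|mean_value R m x - mean_value R m y| <= eta * mean_width R m x].
Proof.
move=> eta_ge0; have [|none] := boolP [exists x, exists y, [&& x \in X, y \in X,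
    x != y & `|mean_value R m x - mean_value R m y| <= eta * mean_width R m x]].
  by case/existsP=> x /existsP[y /and4P[]]; exists x, y.
rewrite ltNge mulr_sumr; case/negP.
apply: (sum_disjoint_intervals_le (a := mean_value R m))
  => [|x _|x _|x y xX yX].
- by rewrite mulr_ge0 // addr_ge0.
- exact: mean_value_ge0.
- have := ler_wpM2l eta_ge0 (mean_width_le R m x).
  by have := mean_value_le R m x; lra.
move=> xy le_xy; rewrite leNgt; apply: contra none => lt_xy.
apply/existsP; exists x; apply/existsP; exists y; apply/and4P; split=> //.
by rewrite distrC ger0_norm ?subr_ge0 //; lra.
Qed.

Lemma delta_ge (r : nat) x y eta : let m := (r + n)%N in
    x != y -> 0 < mean_width R m x -> 0 <= eta ->
    `|mean_value R m x - mean_value R m y| <= eta * mean_width R m x ->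
  (expR 1)^-1 - (8 * (expR 1 + 2) / mean_width R m x + 8 * eta +
    tie_freq (P := P) R r) <= delta R x y.
Proof.
move=> m xy w_gt0 eta_ge0; rewrite ler_norml => /andP[lower_mean upper_mean].
have lt_xy := grunbaum_freq_lt w_gt0 eta_ge0
  (fun k => diff_mass_mean_widthC R m k xy) upper_mean.
have lt_yx : (expR 1)^-1 <= freq R (monotone_maps m) (fun g => g y < g x)%N +
    (8 * (expR 1 + 2) / mean_width R m x + 8 * eta).
  apply: grunbaum_freq_lt => // [k|]; first exact: diff_mass_mean_width.
  by lra.
have := freq_lt_le_prob R r x y; have := freq_lt_le_prob R r y x.
by rewrite /delta le_min => prob_yx prob_xy; apply/andP; split; lra.
Qed.

Lemma mean_width_ge_half (r : nat) x : tie_freq (P := P) R r <= 1 / 2 ->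
  1 / 2 * (r.+1%:R / n.+1%:R * win R x) <= mean_width R (r + n) x.
Proof.
move=> ties_le; apply: le_trans (mean_width_ge R r x).
rewrite ler_wpM2r //; last by lra.
by apply: mulr_ge0; [exact: divr_ge0 | exact: win_ge0].
Qed.

Lemma exists_fine_discretization (t : R) : 0 < t -> t <= 1 / 2 ->
  exists r, [/\ (n <= r)%N, tie_freq (P := P) R r <= t &
    forall x, 0 < mean_width R (r + n) x /\
              8 * (expR 1 + 2) / mean_width R (r + n) x <= t].
Proof.
move=> t_gt0 t_le; have e_gt0 := expR_gt0 (1 : R).
pose c : R := (n ^ n.+2)%:R + 8 * (expR 1 + 2) * n.+1%:R.
pose r := (Num.truncn (c / t) + n)%N; exists r.
have c_le : c <= t * r.+1%:R.
  rewrite -ler_pdivrMl // mulrC (le_trans (ltW (truncnS_gt _))) //.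
  by rewrite ler_nat ltnS leq_addr.
have e_ge0 : 0 <= 8 * (expR 1 + 2) * n.+1%:R :> R.
  by rewrite !mulr_ge0 // addr_ge0 // ltW.
have ties_le : tie_freq (P := P) R r <= t.
  apply: le_trans (tie_freq_le R r) _; rewrite ler_pdivrMr //.
  apply: (@le_trans _ _ c); first by rewrite lerDl.
  by rewrite (le_trans c_le) // ler_pM2l // ler_nat ltnS leq_addr.
split=> [||x]; rewrite ?leq_addl //.
have width_ge : r.+1%:R / n.+1%:R <= mean_width R (r + n) x.
  apply: le_trans (mean_width_ge_half x (le_trans ties_le t_le)).
  have scale_ge0 : 0 <= r.+1%:R / n.+1%:R :> R by rewrite divr_ge0.
  have := ler_wpM2l scale_ge0 (win_ge2 R x).
  by move: (_ / _) (win R x) => scale w; lra.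
have width_gt0 : 0 < mean_width R (r + n) x.
  by apply: lt_le_trans width_ge; rewrite divr_gt0.
split=> //; rewrite ler_pdivrMr //.
apply: le_trans (ler_wpM2l (ltW t_gt0) width_ge).
rewrite mulrA ler_pdivlMr // (le_trans _ c_le) //.
by rewrite /c lerDr.
Qed.

Lemma sum_mean_width_gt (r : nat) eta X :
    (0 < n <= r)%N -> 0 < eta -> tie_freq (P := P) R r <= 1 / 2 ->
    8 * (1 + eta^-1) * n%:R <= \sum_(x in X) win R x ->
  (1 + eta) * (r + n)%:R < eta * \sum_(x in X) mean_width R (r + n) x.
Proof.
case/andP=> n_gt0 nr eta_gt0 ties_le win_ge.
have width_ge : 1 / 2 * (r.+1%:R / n.+1%:R) * \sum_(x in X) win R x <=
    \sum_(x in X) mean_width R (r + n) x.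
  rewrite mulr_sumr; apply: ler_sum => x _; rewrite -mulrA.
  exact: mean_width_ge_half.
have n_ge1 : 1 <= n%:R :> R by rewrite ler1n.
have half : 1 / 2 <= n%:R / n.+1%:R :> R.
  by rewrite ler_pdivlMr // -(natr1 n); lra.
have scale_ge0 : 0 <= 4 * (1 + eta^-1) * r.+1%:R :> R.
  by rewrite !mulr_ge0 // addr_ge0 // invr_ge0 ltW.
have sum_ge : 2 * (1 + eta^-1) * r.+1%:R <=
    \sum_(x in X) mean_width R (r + n) x.
  apply: le_trans width_ge; have := ler_wpM2l scale_ge0 half.
  have : 0 <= 1 / 2 * (r.+1%:R / n.+1%:R) :> R by rewrite mulr_ge0 ?divr_ge0.
  move=> /ler_wpM2l/(_ _ _ win_ge).
  by move: (n.+1%:R^-1) (eta^-1) (\sum_(x in X) win R x) => v u w; lra.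
apply: lt_le_trans (ler_wpM2l (ltW eta_gt0) sum_ge).
have -> : eta * (2 * (1 + eta^-1) * r.+1%:R) = (1 + eta) * (2 * r.+1%:R).
  by field; rewrite gt_eqF.
rewrite ltr_pM2l ?addr_gt0 // -natrM ltr_nat; lia.
Qed.

End Balance.

Theorem theorem2p10 (R : realType) (eps : R) (eps_gt0 : 0 < eps) :
  exists C : R, forall (d : Order.disp_t) (P : finPOrderType d),
    (0 < #|P|)%N ->
    forall X : {set P},
      C * #|P|%:R <= \sum_(x in X) win R x ->
      exists x y : P,
        [/\ x \in X, y \in X, x <> y & (expR 1)^-1 - eps < delta R x y].
Proof.
pose eta := eps / 32; have eta_gt0 : 0 < eta by rewrite divr_gt0.
exists (8 * (1 + eta^-1)) => d P P_gt0 X win_ge.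
pose t := Num.min (1 / 2) (eps / 4).
have t_half : t <= 1 / 2 by rewrite ge_min lexx.
have t_eps : t <= eps / 4 by rewrite ge_min lexx orbT.
have t_gt0 : 0 < t by rewrite lt_min !divr_gt0.
have [r [le_nr ties_le width_t]] :=
  exists_fine_discretization (P := P) t_gt0 t_half.
have [|x [y [xX yX xy close]]] :=
  exists_close_means (m := (r + #|P|)%N) (X := X) (ltW eta_gt0).
  by apply: sum_mean_width_gt; rewrite ?P_gt0 // (le_trans ties_le).
exists x, y; split=> //; first exact/eqP.
have [width_gt0 width_le] := width_t x.
have := delta_ge xy width_gt0 (ltW eta_gt0) close; rewrite /eta; lra.
Qed.
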